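(* Let $(E,\pi,M)$ be a vector bundle, let $((F,\nu,N),[\,,]_{F,h},(\rho,\mathrm{Id}_N))$ be a generalized Lie algebroid, and let $\rho\Gamma$ be a linear $\rho$-connection for $(E,\pi,M)$ with components $\rho\Gamma^a_{b\alpha}$. With the connection forms $\Omega^a_b$, the scalar $2$-forms $(\rho,h)\mathbb T^a$ of the $(\rho,h)$-torsion (which is defined when $(E,\pi,M)=(F,\nu,N)$) and the scalar $2$-forms $(\rho,h)\mathbb R^a_b$ of the $(\rho,h)$-curvature, the identities $$(\rho,h)\mathbb T^a=d^{h^*F}S^a+\Omega^a_b\wedge S^b\qquad(C_1)$$ and $$(\rho,h)\mathbb R^a_b=d^{h^*F}\Omega^a_b+\Omega^a_c\wedge\Omega^c_b\qquad(C_2)$$ hold good (the first, respectively the second, identity of Cartan type; repeated indices are summed). In the particular case of Lie algebroids, $h=\mathrm{Id}_M$, the identities $(C_1)$ and $(C_2)$ become $$\rho\mathbb T^a=d^Fs^a+\omega^a_b\wedge s^b\quad\text{and}\quad\rho\mathbb R^a_b=d^F\omega^a_b+\omega^a_c\wedge\omega^c_b$$ respectively. In the classical case, $\rho=\mathrm{Id}_{TM}$, these become $$\mathbb T^i=d\,dx^i+\omega^i_j\wedge dx^j=\omega^i_j\wedge dx^j\quad\text{and}\quad\mathbb R^i_j=d\omega^i_j+\omega^i_h\wedge\omega^h_j$$ respectively.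
   Context: $\mathcal F(N)$ is the ring of smooth real functions on a manifold $N$, and $\Gamma(F,\nu,N)$ is the $\mathcal F(N)$-module of sections of a vector bundle $\nu:F\to N$. For a vector bundle morphism $(\varphi,\varphi_0)$ with $\varphi_0$ a diffeomorphism, $\Gamma(\varphi,\varphi_0)u=\varphi\circ u\circ\varphi_0^{-1}$ on sections. Repeated indices are summed. Generalized Lie algebroid $((F,\nu,N),[\,,]_{F,h},(\rho,\eta))$: manifolds $M,N$, diffeomorphisms $h:M\to N$ and $\eta:N\to M$, a vector bundle $(F,\nu,N)$, a vector bundle morphism $(\rho,\eta)$ from $(F,\nu,N)$ to $(TM,\tau_M,M)$, and an operation $[\,,]_{F,h}$ on $\Gamma(F,\nu,N)$ such that: $[u,fv]_{F,h}=f[u,v]_{F,h}+(\Gamma(Th\circ\rho,h\circ\eta)(u)f)\,v$ for all sections $u,v$ and $f\in\mathcal F(N)$; $(\Gamma(F,\nu,N),+,\cdot,[\,,]_{F,h})$ is a Lie $\mathcal F(N)$-algebra; and $\Gamma(Th\circ\rho,h\circ\eta)$ is a Lie algebra morphism from it to $(\Gamma(TN,\tau_N,N),+,\cdot,[\,,]_{TN})$. Here $\eta=\mathrm{Id}_N$. Pull-back Lie algebroid: let $\{t_\alpha\}$ be a local frame of $F$, $[t_\alpha,t_\beta]_{F,h}=L^\gamma_{\alpha\beta}t_\gamma$, and let $\rho^i_\alpha$ be the local components of $\rho$. The pull-back bundle $(h^*F,h^*\nu,M)$ has the local frame $T_\alpha$, $T_\alpha(x)=t_\alpha(h(x))$.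 It is a Lie algebroid over $M$ with anchor $\overset{h^*F}{\rho}(Z^\alpha T_\alpha)=Z^\alpha(\rho^i_\alpha\circ h)\frac{\partial}{\partial x^i}$ (over $\mathrm{Id}_M$) and bracket given by $[T_\alpha,T_\beta]_{h^*F}=(L^\gamma_{\alpha\beta}\circ h)T_\gamma$, $[T_\alpha,fT_\beta]_{h^*F}=f(L^\gamma_{\alpha\beta}\circ h)T_\gamma+(\rho^i_\alpha\circ h)\frac{\partial f}{\partial x^i}T_\beta$, $[fT_\alpha,T_\beta]_{h^*F}=-[T_\beta,fT_\alpha]_{h^*F}$, for $f\in\mathcal F(M)$. Its coframe is $\{T^\alpha\}$. The frame and coframe of this pull-back bundle are also written $\{S_c\}$, $\{S^c\}$; this is the notation used when $E=F$, so that $h^*E=h^*F$. Forms: a $q$-form is a $q$-linear map $\omega:\Gamma(h^*F,h^*\nu,M)^q\to\mathcal F(M)$ with $\omega(z_{\sigma(1)},\dots,z_{\sigma(q)})=\mathrm{sgn}(\sigma)\omega(z_1,\dots,z_q)$ for all permutations $\sigma$. The exterior product is $(\omega\wedge\theta)(z_1,\dots,z_{q+r})=\frac1{q!r!}\sum_{\sigma\in\Sigma_{q+r}}\mathrm{sgn}(\sigma)\,\omega(z_{\sigma(1)},\dots,z_{\sigma(q)})\,\theta(z_{\sigma(q+1)},\dots,z_{\sigma(q+r)})$. The exterior differentiation operator is $d^{h^*F}\omega(z_0,\dots,z_q)=\sum_i(-1)^i\,\Gamma(\overset{h^*F}{\rho},\mathrm{Id}_M)z_i\big(\omega(z_0,\dots,\hat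 z_i,\dots,z_q)\big)+\sum_{i<j}(-1)^{i+j}\omega([z_i,z_j]_{h^*F},z_0,\dots,\hat z_i,\dots,\hat z_j,\dots,z_q)$; for $h=\mathrm{Id}_M$ it is written $d^F$, and for the tangent bundle $d$. Covariant derivatives: let $\{s_a\}$ be a local frame of $E$ with coframe $\{s^a\}$. The components $\rho\Gamma^a_{b\alpha}$ define $\rho\dot D:\Gamma(h^*F)\times\Gamma(E)\to\Gamma(E)$, function-linear in the first argument, additive in the second, with $\rho\dot D_Z(fu)=f\,\rho\dot D_Zu+(\Gamma(\overset{h^*F}{\rho},\mathrm{Id}_M)Z\,f)\,u$ and $\rho\dot D_{T_\alpha}s_b=\rho\Gamma^a_{b\alpha}s_a$. If $(E,\pi,M)=(F,\nu,N)$, the same components define in the same way $\rho\ddot D:\Gamma(h^*E)\times\Gamma(h^*E)\to\Gamma(h^*E)$ with $\rho\ddot D_{S_c}S_b=\rho\Gamma^a_{bc}S_a$. Connection forms: $\Omega^a_b=\rho\Gamma^a_{bc}S^c$. For Lie algebroids ($h=\mathrm{Id}_M$) they are $\omega^a_b=\rho\Gamma^a_{bc}s^c$, and in the classical case $\omega^i_j=\Gamma^i_{jk}dx^k$. $(\rho,h)$-torsion (for $(E,\pi,M)=(F,\nu,N)$): $(\rho,h)\mathbb T(U,V)=\rho\ddot D_UV-\rho\ddot D_VU-[U,V]_{h^*E}$ for $U,V\in\Gamma(h^*E,h^*\pi,M)$. Put $(\rho,h)\mathbb T(S_a,S_b)=(\rho,h)\mathbb T^c_{ab}S_c$. The scalar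 $2$-forms are $(\rho,h)\mathbb T^c=(\rho,h)\mathbb T^c_{ab}\,S^a\wedge S^b$. For $h=\mathrm{Id}_M$: $\rho\mathbb T^c=\rho\mathbb T^c_{ab}\,s^a\wedge s^b$; classically $\mathbb T^i=\mathbb T^i_{jk}\,dx^j\wedge dx^k$. $(\rho,h)$-curvature: $(\rho,h)\mathbb R(Z,V)u=\rho\dot D_Z(\rho\dot D_Vu)-\rho\dot D_V(\rho\dot D_Zu)-\rho\dot D_{[Z,V]_{h^*F}}u$ for $Z,V\in\Gamma(h^*F,h^*\nu,M)$, $u\in\Gamma(E,\pi,M)$. Put $(\rho,h)\mathbb R(T_\beta,T_\alpha)s_b=(\rho,h)\mathbb R^a_{b\,\alpha\beta}s_a$. The scalar $2$-forms are $(\rho,h)\mathbb R^a_b=(\rho,h)\mathbb R^a_{b\,\alpha\beta}\,T^\alpha\wedge T^\beta$. For $h=\mathrm{Id}_M$: $\rho\mathbb R^a_b=\rho\mathbb R^a_{b\,\alpha\beta}\,t^\alpha\wedge t^\beta$, with $\{t^\alpha\}$ the coframe of $F$; classically $\mathbb R^a_b=\mathbb R^a_{b\,hk}\,dx^h\wedge dx^k$.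
   Formalization: The scalar 2-forms of torsion and curvature are summed over increasing index pairs only (all pairs would give a factor 2), and the curvature components are taken from R(T_α,T_β)s_b instead of R(T_β,T_α)s_b (the stated order gives the wrong sign in C_2). *)

(* Defs.v *)
From mathcomp Require Import all_boot all_order all_algebra perm.
From mathcomp Require Import boolp classical_sets functions reals topology.
From mathcomp Require Import normedtype landau derive.

Set Implicit Arguments.
Unset Strict Implicit.
Unset Printing Implicit Defensive.

Import Order.TTheory GRing.Theory Num.Theory.
Import numFieldNormedType.Exports.

Local Open Scope classical_set_scope.
Local Open Scope ring_scope.

Section smooth_euclidean.
Context {R : realType}.

Fixpoint Ck (n : nat) (W : normedModType R) (k : nat) (O : set 'rV[R]_n)
    (f : 'rV[R]_n -> W) : Prop :=
  if k is k'.+1 then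
    (forall x, O x -> differentiable f x) /\ (forall v, Ck k' O ('D_v f))
  else forall x, O x -> {for x, continuous f}.

Definition smooth (n : nat) (W : normedModType R) (O : set 'rV[R]_n)
    (f : 'rV[R]_n -> W) : Prop := forall k, Ck k O f.


Lemma differentiable_near0 (V W : normedModType R) (e : V -> W) x :
  (\forall y \near x, e y = 0) -> differentiable e x.
Proof.
move=> e0.
have E : e \o shift x = cst (e x) + (0 : V -> W) +o_ 0 id.
  apply/eqaddoP => eps eps0.
  have : \forall h \near (0 : V), e (h + x) = 0.
    have := e0; rewrite (near_shift 0) subr0; exact.
  apply: filterS => h h0; rewrite !fctE /= h0 (nbhs_singleton e0) addr0 subrr normr0.
  by rewrite mulr_ge0 // ltW.
have c0 : continuous (0 : V -> W) by exact: cst_continuous.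
by apply/diff_locallyP; rewrite (diff_unique c0 E).
Qed.

Lemma differentiable_near (V W : normedModType R) (f g : V -> W) x :
  {near x, f =1 g} -> differentiable f x -> differentiable g x.
Proof.
move=> fg df; have -> : g = f + (g - f) by rewrite addrC subrK.
apply: differentiableD => //; apply: differentiable_near0.
by apply: filterS fg => y fgy; rewrite !fctE fgy subrr.
Qed.

Lemma Ck_sub n (W : normedModType R) k (O O' : set 'rV[R]_n)
    (f : 'rV[R]_n -> W) :
  O' `<=` O -> Ck k O f -> Ck k O' f.
Proof.
elim: k f => [|k IH] f sO /=; first by move=> + x /sO; exact.
by move=> [df Df]; split=> [x /sO/df//|v]; exact: IH.
Qed.

Lemma Ck_local n (W : normedModType R) k (O : set 'rV[R]_n)
    (f : 'rV[R]_n -> W) :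
  (forall x, O x -> exists2 P', P' x & Ck k P' f) -> Ck k O f.
Proof.
elim: k f => [|k IH] f /= loc; first by move=> x /loc[P' P'x cf]; apply: cf.
split=> [x /loc[P' P'x [df _]]|v]; first exact: df.
by apply: IH => x /loc[P' P'x [_ Df]]; exists P'.
Qed.

Lemma Ck_cont n (W : normedModType R) k (O : set 'rV[R]_n)
    (f : 'rV[R]_n -> W) :
  Ck k O f -> forall x, O x -> {for x, continuous f}.
Proof.
by case: k => [//|k] [df _] x /df/differentiable_continuous.
Qed.

Lemma CkW n (W : normedModType R) k (O : set 'rV[R]_n)
    (f : 'rV[R]_n -> W) : Ck k.+1 O f -> Ck k O f.
Proof.
elim: k f => [|k IH] f; first exact: Ck_cont.
by move=> [df Df]; split => // v; exact: IH.
Qed.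

Lemma Ck_ext n (W : normedModType R) k (O : set 'rV[R]_n)
    (f g : 'rV[R]_n -> W) :
  open O -> (forall x, O x -> f x = g x) -> Ck k O f -> Ck k O g.
Proof.
move=> oO; elim: k f g => [|k IH] f g fg.
  move=> cf x Ox; have nO : nbhs x O by exact: open_nbhs_nbhs.
  have nfg : {near x, f =1 g} by apply: filterS nO.
  move: (cf x Ox); rewrite /prop_for /continuous_at -(fg x Ox).
  move=> cfx; apply: cvg_trans cfx; exact: near_eq_cvg nfg.
have nfg x : O x -> {near x, f =1 g}.
  by move=> Ox; apply: filterS (open_nbhs_nbhs (conj oO Ox)).
move=> [df Df]; split=> [x Ox|v].
  exact: differentiable_near (nfg _ Ox) (df _ Ox).
apply: IH (Df v) => x Ox; exact: near_eq_derive (nfg _ Ox).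
Qed.

Lemma Ck_cst n (W : normedModType R) k (O : set 'rV[R]_n) (w : W) :
  Ck k O (fun=> w).
Proof.
elim: k w => [|k IH] w; first by move=> x _; exact: cst_continuous.
split=> [x _|v]; first exact: differentiable_cst.
rewrite (_ : 'D_v _ = fun=> 0) //; apply/funext => x.
exact: derive_cst.
Qed.

Lemma Ck_add n (W : normedModType R) k (O : set 'rV[R]_n)
    (f g : 'rV[R]_n -> W) :
  open O -> Ck k O f -> Ck k O g -> Ck k O (fun x => f x + g x).
Proof.
move=> oO; elim: k f g => [|k IH] f g.
  by move=> cf cg x Ox; apply: continuousD; [exact: cf|exact: cg].
move=> [df Df] [dg Dg]; split=> [x Ox|v].
  by apply: differentiableD; [exact: df|exact: dg].
apply: (@Ck_ext _ _ _ _ (fun x => 'D_v f x + 'D_v g x)) => //; last exact: IH (Df v) (Dg v).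
move=> x Ox; rewrite -[RHS]/('D_v (f + g) x).
by rewrite deriveD //; apply: diff_derivable; [exact: df|exact: dg].
Qed.

Lemma Ck_sum n (W : normedModType R) k (O : set 'rV[R]_n) m
    (f : 'I_m -> 'rV[R]_n -> W) :
  open O -> (forall j, Ck k O (f j)) -> Ck k O (fun x => \sum_j f j x).
Proof.
move=> oO cf.
have : forall s : seq 'I_m, Ck k O (fun x => \sum_(j <- s) f j x).
  elim=> [|j s IH]; first by under eq_fun do rewrite big_nil; exact: Ck_cst.
  by under eq_fun do rewrite big_cons; exact: Ck_add.
exact.
Qed.

Lemma Ck_Zl n (W : normedModType R) k (O : set 'rV[R]_n)
    (a : 'rV[R]_n -> R) (w : W) :
  open O -> Ck k O a -> Ck k O (fun x => a x *: w).
Proof.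
move=> oO; elim: k a => [|k IH] a.
  by move=> ca x Ox; apply: continuousZr_tmp; exact: ca.
move=> [da Da]; split=> [x Ox|v]; first exact/differentiableZl/da.
apply: (@Ck_ext _ _ _ _ (fun x => 'D_v a x *: w)) => //; last exact: IH (Da v).
move=> x Ox; rewrite !deriveE; [|exact/differentiableZl/da|exact: da].
by rewrite diffZl //; exact: da.
Qed.

Lemma Ck_mul n k (O : set 'rV[R]_n) (f g : 'rV[R]_n -> R) :
  open O -> Ck k O f -> Ck k O g -> Ck k O (fun x => f x * g x).
Proof.
move=> oO; elim: k f g => [|k IH] f g.
  by move=> cf cg x Ox; apply: continuousM; [exact: cf|exact: cg].
move=> /[dup] /CkW cf [df Df] /[dup] /CkW cg [dg Dg]; split=> [x Ox|v].
  by apply: differentiableM; [exact: df|exact: dg].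
apply: (@Ck_ext _ _ _ _ (fun x => f x * 'D_v g x + g x * 'D_v f x)) => //.
  move=> x Ox; rewrite -[RHS]/('D_v (f * g) x).
  by rewrite deriveM //; apply: diff_derivable; [exact: df|exact: dg].
by apply: Ck_add; [|exact: IH cf (Dg v)|exact: IH cg (Df v)].
Qed.

Lemma Ck_coord n m k (O : set 'rV[R]_n) (f : 'rV[R]_n -> 'rV[R]_m) :
  open O -> Ck k O f <-> (forall j, Ck k O (fun x => f x 0 j)).
Proof.
move=> oO; split; last first.
  move=> cf; have -> : f = fun x => \sum_j f x 0 j *: delta_mx 0 j.
    by apply/funext => x; exact: row_sum_delta.
  by apply: Ck_sum => // j; exact: Ck_Zl.
move=> + j; elim: k f => [|k IH] f.
  move=> cf x Ox; apply: (@continuous_comp _ _ _ f (fun N : 'rV[R]_m => N 0 j)).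
    exact: cf.
  exact: coord_continuous.
move=> [df Df]; split=> [x Ox|v].
  apply: (@differentiable_comp _ _ _ _ f (fun N : 'rV[R]_m => N 0 j)).
    exact: df.
  exact: differentiable_coord.
apply: (@Ck_ext _ _ _ _ (fun x => 'D_v f x 0 j)) => //; last exact: IH (Df v).
by move=> x Ox; rewrite derive_mx ?mxE //; apply: diff_derivable; exact: df.
Qed.

Lemma Ck_comp n m  k (O : set 'rV[R]_n) (P : set 'rV[R]_m)
    (f : 'rV[R]_n -> 'rV[R]_m) (g : 'rV[R]_m -> R) :
  open O -> (forall x, O x -> P (f x)) -> Ck k O f -> Ck k P g ->
  Ck k O (g \o f).
Proof.
move=> oO fOP; elim: k f g fOP => [|k IH] f g fOP.
  move=> cf cg x Ox; apply: continuous_comp; first exact: cf.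
  exact/cg/fOP.
move=> /[dup] /CkW cf [df Df] /[dup] /CkW cg [dg Dg]; split=> [x Ox|v].
  by apply: differentiable_comp; [exact: df|exact/dg/fOP].
pose h x := \sum_j 'D_v f x 0 j * ('D_(delta_mx 0 j) g (f x)).
apply: (@Ck_ext _ _ _ _ h) => // [x Ox|].
  have dfx := df x Ox; have dgx := dg _ (fOP _ Ox).
  have -> : 'D_v (g \o f) x = 'd g (f x) ('D_v f x).
    have dgf : differentiable (g \o f) x by exact: differentiable_comp.
    by rewrite (deriveE v dgf) diff_comp // (deriveE v dfx).
  rewrite [in RHS](row_sum_delta ('D_v f x)) linear_sum /=.
  apply: eq_bigr => j _.
  by rewrite linearZ /= (deriveE _ dgx).
apply: Ck_sum => // j; apply: Ck_mul => //.
  by move: (Df v) => /(Ck_coord _ _ oO); apply.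
exact: (IH f _ fOP cf (Dg (delta_mx 0 j))).
Qed.

Lemma smooth_comp n m p (O : set 'rV[R]_n) (P : set 'rV[R]_m)
    (f : 'rV[R]_n -> 'rV[R]_m) (g : 'rV[R]_m -> 'rV[R]_p) :
  open O -> open P -> (forall x, O x -> P (f x)) -> smooth O f -> smooth P g ->
  smooth O (g \o f).
Proof.
move=> oO oP fOP sf sg k; apply/Ck_coord => // j.
exact: (@Ck_comp _ _ _ _ _ f (fun y => g y 0 j) oO fOP (sf k) ((Ck_coord _ _ oP).1 (sg k) j)).
Qed.

Lemma smooth_derive n (W : normedModType R) (O : set 'rV[R]_n)
    (f : 'rV[R]_n -> W) v : smooth O f -> smooth O ('D_v f).
Proof. by move=> sf k; case: (sf k.+1) => _; apply. Qed.

Lemma smooth_ext n (W : normedModType R) (O : set 'rV[R]_n)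
    (f g : 'rV[R]_n -> W) :
  open O -> (forall x, O x -> f x = g x) -> smooth O f -> smooth O g.
Proof. by move=> oO fg sf k; exact: Ck_ext fg (sf k). Qed.

Lemma smooth_local n (W : normedModType R) (O : set 'rV[R]_n)
    (f : 'rV[R]_n -> W) :
  (forall x, O x -> exists2 P', P' x & smooth P' f) -> smooth O f.
Proof. by move=> loc k; apply: Ck_local => x /loc[P' ? ?]; exists P'. Qed.

Lemma jacobian_comp n m p (f : 'rV[R]_n -> 'rV[R]_m) (g : 'rV[R]_m -> 'rV[R]_p)
    x : differentiable f x -> differentiable g (f x) ->
  'J (g \o f) x = 'J f x *m 'J g (f x).
Proof.
move=> df dg; apply/row_matrixP => i; rewrite !rowE mulmxA.
have dgf : differentiable (g \o f) x by exact: differentiable_comp.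
rewrite -(deriveEjacobian _ dgf) -(deriveEjacobian _ df).
rewrite -(deriveEjacobian _ dg) (deriveE _ dgf) (deriveE _ df) (deriveE _ dg).
by rewrite diff_comp.
Qed.

Lemma row_jacobian n m (f : 'rV[R]_n -> 'rV[R]_m) x i : differentiable f x ->
  row i ('J f x) = 'D_(delta_mx 0 i) f x.
Proof. by move=> df; rewrite (deriveEjacobian _ df); exact: rowE. Qed.

Lemma jacobian_near n m (f g : 'rV[R]_n -> 'rV[R]_m) x :
  {near x, f =1 g} -> differentiable f x -> 'J f x = 'J g x.
Proof.
move=> fg df; have dg := differentiable_near fg df.
apply/row_matrixP => i; apply: etrans (row_jacobian i df) _.
by apply: etrans _ (esym (row_jacobian i dg)); exact: near_eq_derive fg.
Qed.

Lemma jacobian_id n (x : 'rV[R]_n) : 'J (fun y => y) x = 1%:M.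
Proof.
have di : differentiable (fun y : 'rV[R]_n => y) x by exact: ex_diff.
apply/row_matrixP => i; apply: etrans (row_jacobian i di) _.
by rewrite row1; exact: derive_id.
Qed.

End smooth_euclidean.

Section algebroids.
Context {R : realType}.

Record chart (M : topologicalType) (n : nat) := Chart {
  cdom : set M;
  cmap : M -> 'rV[R]_n;
  cinv : 'rV[R]_n -> M;
  cdom_open : open cdom;
  cimg_open : open (cmap @` cdom);
  cmapK : forall x, cdom x -> cinv (cmap x) = x;
  cmap_cont : forall x, cdom x -> {for x, continuous cmap};
  cinv_cont : forall x, cdom x -> {for cmap x, continuous cinv} }.

Definition cimg (M : topologicalType) n (c : chart M n) (U : set M) :=
  cmap c @` (cdom c `&` U).

Definition compatible (M : topologicalType) n (c c' : chart M n) :=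
  smooth (cimg c (cdom c')) (cmap c' \o cinv c).

Record manifold := Manifold {
  mtop :> topologicalType;
  mdim : nat;
  mhausdorff : hausdorff_space mtop;
  mcountable : @second_countable mtop;
  atlas : set (chart mtop mdim);
  atlas_cover : forall x, exists c, atlas c /\ cdom c x;
  atlas_compat : forall c c', atlas c -> atlas c' -> compatible c c' }.

(* membership in the maximal atlas *)
Definition smooth_chart (M : manifold) (c : chart M (mdim M)) :=
  forall c', atlas c' -> compatible c c' /\ compatible c' c.

Definition chart_at (M : manifold) (x : M) : chart M (mdim M) :=
  sval (cid (atlas_cover x)).

Lemma chart_at_atlas (M : manifold) (x : M) : atlas (chart_at x).
Proof. by rewrite /chart_at; case: cid => c []. Qed.

Lemma chart_at_dom (M : manifold) (x : M) : cdom (chart_at x) x.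
Proof. by rewrite /chart_at; case: cid => c []. Qed.

Definition smooth_on (M : manifold) (W : normedModType R) (U : set M)
    (f : M -> W) :=
  forall c : chart M (mdim M), atlas c -> smooth (cimg c U) (f \o cinv c).

Definition smooth_map (M N : manifold) (g : M -> N) :=
  continuous g /\
  forall (c : chart M (mdim M)) (c' : chart N (mdim N)), atlas c -> atlas c' ->
    smooth (cimg c (g @^-1` cdom c')) (cmap c' \o g \o cinv c).

Record diffeo (M N : manifold) := Diffeo {
  dfun :> M -> N;
  dinv : N -> M;
  dfunK : cancel dfun dinv;
  dinvK : cancel dinv dfun;
  dfun_smooth : smooth_map dfun;
  dinv_smooth : smooth_map dinv }.

Lemma smooth_map_id (M : manifold) : smooth_map (fun x : M => x).
Proof. by split=> [|c c' ac ac']; [move=> x|exact: (@atlas_compat M c c' ac ac')]. Qed.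

Definition diffeo_id (M : manifold) : diffeo M M :=
  Diffeo (fun=> erefl) (fun=> erefl) (@smooth_map_id M) (@smooth_map_id M).

Lemma open_cimg (M : topologicalType) n (c : chart M n) (U : set M) :
  open U -> open (cimg c U).
Proof.
move=> oU; rewrite openE => _ [x [cx Ux] <-]; rewrite /interior.
have nD : nbhs (cmap c x) (cmap c @` cdom c).
  by apply: open_nbhs_nbhs; split; [exact: cimg_open|exists x].
have nU : nbhs (cmap c x) (cinv c @^-1` U).
  by apply: (cinv_cont cx); rewrite cmapK //; exact: open_nbhs_nbhs.
apply: filterS (filterI nD nU) => _ [[y cy <-]] /=.
by rewrite cmapK // => Uy; exists y.
Qed.

Lemma smooth_on_sub (M : manifold) (W : normedModType R) (U V : set M)
    (f : M -> W) : U `<=` V -> smooth_on V f -> smooth_on U f.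
Proof.
move=> UV sf c ac k; apply: Ck_sub (sf c ac k) => _ [x [cx Ux] <-].
by exists x => //; split => //; exact: UV.
Qed.

Lemma smooth_on_comp (M N : manifold) m (U : set N) (g : M -> N)
    (f : N -> 'rV[R]_m) :
  open U -> smooth_map g -> smooth_on U f -> smooth_on (g @^-1` U) (f \o g).
Proof.
move=> oU [cg sg] sf c ac; apply: smooth_local => _ [x [cx Ux] <-].
pose c' := chart_at (g x).
have oc' : open (cdom c' `&` U) by apply: openI => //; exact: cdom_open.
have og : open (g @^-1` (cdom c' `&` U)) by apply: open_comp => // y _; exact: cg.
have ac' : atlas c' by exact: chart_at_atlas.
exists (cimg c (g @^-1` (cdom c' `&` U))).
  by exists x => //; split => //; split => //; exact: chart_at_dom.
have oI := open_cimg (c := c) og.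
apply: (@smooth_ext _ _ _ _ ((f \o cinv c') \o (cmap c' \o g \o cinv c))) => //.
  move=> _ [y [cy [c'y Uy]] <-] /=; rewrite (cmapK cy) /= cmapK //.
apply: (smooth_comp oI _ _ _ (sf c' ac')).
- exact: open_cimg.
- move=> _ [y [cy [c'y Uy]] <-] /=; rewrite (cmapK cy).
  by exists (g y).
- move=> k; apply: Ck_sub (sg c c' ac ac' k) => _ [y [cy [c'y Uy]] <-].
  by exists y.
Qed.

Record vtriv (M : manifold) (r : nat) (fib : M -> lmodType R) := VTriv {
  tdom : set M;
  tdom_open : open tdom;
  tmap : forall x, fib x -> 'rV[R]_r;
  tinv : forall x, 'rV[R]_r -> fib x;
  tmap_linear : forall x, tdom x -> forall a (u v : fib x),
    tmap (a *: u + v) = a *: tmap u + tmap v :> 'rV[R]_r;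
  tmapK : forall x, tdom x -> cancel (@tmap x) (@tinv x);
  tinvK : forall x, tdom x -> cancel (@tinv x) (@tmap x) }.

(* A vector bundle is given by its fibres together with local trivializations
   whose transition functions are smooth: this determines the manifold structure
   of the total space. *)
Record vbundle (M : manifold) := VBundle {
  vrank : nat;
  vfib :> M -> lmodType R;
  vatlas : set (vtriv vrank vfib);
  vatlas_cover : forall x, exists p, vatlas p /\ tdom p x;
  vatlas_compat : forall p q, vatlas p -> vatlas q -> forall v : 'rV[R]_vrank,
    smooth_on (tdom p `&` tdom q) (fun x => tmap q (tinv p x v)) }.

Definition sec (M : manifold) (F : vbundle M) := forall x, F x.

Definition smooth_sec (M : manifold) (F : vbundle M) (U : set M) (u : sec F) :=
  forall p : vtriv (vrank F) F, vatlas p ->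
    smooth_on (U `&` tdom p) (fun x => tmap p (u x)).

Record vmorph (N M : manifold) (g : N -> M) (F : vbundle N) (G : vbundle M) :=
  VMorph {
    vmap :> forall y, F y -> G (g y);
    vmap_linear : forall y a (u v : F y),
      vmap (a *: u + v) = a *: vmap u + vmap v;
    vmap_smooth : forall (p : vtriv (vrank F) F) (q : vtriv (vrank G) G),
      vatlas p -> vatlas q -> forall v,
      smooth_on (tdom p `&` g @^-1` tdom q)
        (fun y => tmap q (vmap (tinv p y v))) }.

Section pullback.
Variables (M N : manifold) (h : diffeo M N) (F : vbundle N).

Let pfib (x : M) := F (h x).

Definition ptriv (p : vtriv (vrank F) F) : vtriv (vrank F) pfib.
Proof.
refine (@VTriv M (vrank F) pfib (h @^-1` tdom p) _
  (fun x => @tmap _ _ _ p (h x)) (fun x => @tinv _ _ _ p (h x)) _ _ _).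
- apply: open_comp (tdom_open p) => x _; exact: (dfun_smooth h).1.
- by move=> x; exact: tmap_linear.
- by move=> x; exact: tmapK.
- by move=> x; exact: tinvK.
Defined.

Lemma ptriv_cover x : exists q, (ptriv @` @vatlas N F) q /\ tdom q x.
Proof.
by have [p [ap px]] := vatlas_cover F (h x); exists (ptriv p); split=> //; exists p.
Qed.

Lemma ptriv_compat p q : (ptriv @` @vatlas N F) p -> (ptriv @` @vatlas N F) q ->
  forall v : 'rV[R]_(vrank F),
  smooth_on (tdom p `&` tdom q) (fun x => tmap q (tinv p x v)).
Proof.
move=> [p' ap <-] [q' aq <-] v.
apply: (smooth_on_comp _ (dfun_smooth h) (vatlas_compat ap aq v)).
by apply: openI; exact: tdom_open.
Qed.

Definition pullback : vbundle M := VBundle ptriv_cover ptriv_compat.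

End pullback.

Section tangent.
Variable M : manifold.
Let n := mdim M.
Let tfib (x : M) : lmodType R := 'rV[R]_n.

Lemma trans_diff (c c' : chart M n) (x : M) : compatible c c' ->
  cdom c x -> cdom c' x -> differentiable (cmap c' \o cinv c) (cmap c x).
Proof.
move=> cc' cx c'x; have [+ _] := cc' 1%N; apply.
by exists x.
Qed.

Lemma trans_comp (c1 c2 c3 : chart M n) (x : M) :
  atlas c1 -> atlas c2 -> atlas c3 -> cdom c1 x -> cdom c2 x -> cdom c3 x ->
  'J (cmap c2 \o cinv c1) (cmap c1 x) *m 'J (cmap c3 \o cinv c2) (cmap c2 x) =
  'J (cmap c3 \o cinv c1) (cmap c1 x).
Proof.
move=> a1 a2 a3 x1 x2 x3.
have d12 := trans_diff (atlas_compat a1 a2) x1 x2.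
have d23 := trans_diff (atlas_compat a2 a3) x2 x3.
have d13 := trans_diff (atlas_compat a1 a3) x1 x3.
have := @jacobian_comp R _ _ _ _ (cmap c3 \o cinv c2) _ d12.
rewrite /= (cmapK x1) => /(_ d23) <-; apply/esym/jacobian_near => //.
have oD := open_cimg (c := c1) (cdom_open c2).
have Dx : cimg c1 (cdom c2) (cmap c1 x) by exists x.
apply: filterS (open_nbhs_nbhs (conj oD Dx)) => _ [y [y1 y2] <-] /=.
by rewrite (cmapK y1) (cmapK y2).
Qed.

Lemma trans_id (c : chart M n) (x : M) : atlas c -> cdom c x ->
  'J (cmap c \o cinv c) (cmap c x) = 1%:M.
Proof.
move=> ac xc; rewrite -(jacobian_id (cmap c x)); apply: jacobian_near.
  have oD := @cimg_open _ _ c.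
  have Dx : (cmap c @` cdom c) (cmap c x) by exists x.
  apply: filterS (open_nbhs_nbhs (conj oD Dx)) => _ [y yc <-] /=.
  by rewrite (cmapK yc).
exact: (trans_diff (atlas_compat ac ac) xc xc).
Qed.

Definition ttriv (c : chart M n) (ac : atlas c) : vtriv n tfib.
Proof.
refine (@VTriv M n tfib (cdom c) (cdom_open c)
  (fun x (v : 'rV[R]_n) =>
     v *m 'J (cmap c \o cinv (chart_at x)) (cmap (chart_at x) x))
  (fun x (v : 'rV[R]_n) => v *m 'J (cmap (chart_at x) \o cinv c) (cmap c x))
  _ _ _).
- by move=> x _ a u v; rewrite mulmxDl scalemxAl.
- move=> x cx v; have [ax dx] := (chart_at_atlas x, chart_at_dom x).
  by rewrite -mulmxA trans_comp // trans_id // mulmx1.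
- move=> x cx v; have [ax dx] := (chart_at_atlas x, chart_at_dom x).
  by rewrite -mulmxA trans_comp // trans_id // mulmx1.
Defined.

Definition tatlas : set (vtriv n tfib) :=
  [set p | exists c (ac : atlas c), p = ttriv ac].

Lemma ttriv_cover x : exists p, tatlas p /\ tdom p x.
Proof.
have [c [ac cx]] := atlas_cover x.
by exists (ttriv ac); split=> //; exists c, ac.
Qed.

Lemma ttriv_compat p q : tatlas p -> tatlas q -> forall v : 'rV[R]_n,
  smooth_on (tdom p `&` tdom q) (fun x => tmap q (tinv p x v)).
Proof.
move=> [c [ac ->]] [c' [ac' ->]] v d ad /=.
have oD : open (cimg d (cdom c `&` cdom c')).
  by apply: open_cimg; apply: openI; exact: cdom_open.
pose f := ('D_v (cmap c' \o cinv c)) \o (cmap c \o cinv d).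
apply: (@smooth_ext _ _ _ _ f) => //.
  move=> _ [x [dx [cx c'x]] <-]; rewrite /f /= (cmapK dx).
  have [ax xx] := (chart_at_atlas x, chart_at_dom x).
  rewrite -mulmxA trans_comp // deriveEjacobian //.
  exact: trans_diff (atlas_compat ac ac') cx c'x.
apply: (smooth_comp oD _ _ _ (smooth_derive v (atlas_compat ac ac'))).
- exact/open_cimg/cdom_open.
- by move=> _ [x [dx [cx c'x]] <-] /=; rewrite (cmapK dx); exists x.
- move=> k; apply: Ck_sub (atlas_compat ad ac k) => _ [x [dx [cx c'x]] <-].
  by exists x.
Qed.

(* The fibre at x is R^n read in the coordinates of chart_at x; the chart c
   trivializes it through the Jacobian of c o (chart_at x)^-1. *)
Definition tangent : vbundle M := VBundle ttriv_cover ttriv_compat.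

End tangent.

Definition vact (M : manifold) (X : sec (tangent M)) (f : M -> R) (x : M) : R :=
  'D_(X x) (f \o cinv (chart_at x)) (cmap (chart_at x) x).

Definition is_lie_bracket (M : manifold) (X Y Z : sec (tangent M)) :=
  forall (O : set M) (f : M -> R), open O -> smooth_on O f ->
  forall x, O x -> vact Z f x = vact X (vact Y f) x - vact Y (vact X f) x.

Definition tangent_map (M N : manifold) (g : M -> N) (x : M)
    (v : tangent M x) : tangent N (g x) :=
  (v : 'rV[R]_(mdim M)) *m
    'J (cmap (chart_at (g x)) \o g \o cinv (chart_at x)) (cmap (chart_at x) x).

(* Gamma(Th o rho, h o eta). The value at y lies in the fibre of TN at
   h (eta (eta^-1 (h^-1 y))) = y; all the fibres of TN are the same type. *)
Definition anchor_field (M N : manifold) (h : diffeo M N) (eta : diffeo N M)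
    (F : vbundle N) (rho : vmorph eta F (tangent M)) (u : sec F) :
    sec (tangent N) :=
  fun y => let z := dinv eta (dinv h y) in tangent_map h (rho z (u z)).

(* The operation [ , ] matters on global smooth sections only. *)
Record gen_lie_algebroid (M N : manifold) (h : diffeo M N) (eta : diffeo N M)
    (F : vbundle N) := GenLieAlgebroid {
  anchor : vmorph eta F (tangent M);
  bracket : sec F -> sec F -> sec F;
  bracket_smooth : forall u v : sec F, smooth_sec setT u -> smooth_sec setT v ->
    smooth_sec setT (bracket u v);
  bracket_leibniz : forall (u v : sec F) (f : N -> R),
    smooth_sec setT u -> smooth_sec setT v -> smooth_on setT f ->
    forall y, bracket u (fun z => f z *: v z) y =
      f y *: bracket u v y + vact (anchor_field h anchor u) f y *: v y;
  bracket_linear : forall (a : R) (u v w : sec F),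
    smooth_sec setT u -> smooth_sec setT v -> smooth_sec setT w ->
    forall y, bracket (fun z => a *: u z + v z) w y =
      a *: bracket u w y + bracket v w y;
  bracket_anti : forall u v : sec F, smooth_sec setT u -> smooth_sec setT v ->
    forall y, bracket u v y = - bracket v u y;
  bracket_jacobi : forall u v w : sec F,
    smooth_sec setT u -> smooth_sec setT v -> smooth_sec setT w ->
    forall y, bracket u (bracket v w) y + bracket v (bracket w u) y +
      bracket w (bracket u v) y = 0;
  bracket_anchor : forall u v : sec F,
    smooth_sec setT u -> smooth_sec setT v ->
    is_lie_bracket (anchor_field h anchor u) (anchor_field h anchor v)
      (anchor_field h anchor (bracket u v)) }.

Definition is_frame (M : manifold) (F : vbundle M) (U : set M)
    (t : 'I_(vrank F) -> sec F) :=
  (forall i, smooth_sec U (t i)) /\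
  forall x, U x -> forall v : F x,
    exists! c : 'rV[R]_(vrank F), v = \sum_i c 0 i *: t i x.

Definition coords (M : manifold) (F : vbundle M) (t : 'I_(vrank F) -> sec F)
    (x : M) (v : F x) : 'rV[R]_(vrank F) :=
  xget 0 [set c : 'rV[R]_(vrank F) | v = \sum_i c 0 i *: t i x].

(* the vector field d/dx^i of the chart c *)
Definition coord_frame (M : manifold) (c : chart M (mdim M)) (i : 'I_(mdim M)) :
    sec (tangent M) :=
  fun x => (delta_mx 0 i : 'rV[R]_(mdim M)) *m
    'J (cmap (chart_at x) \o cinv c) (cmap c x).

(* Local data of a Lie algebroid structure on B: coordinates x^i, a local frame
   t_a of B, the components rho^i_a of the anchor and the structure functions
   L^g_ab, in this order of the indices: lf_anchor a i and lf_struct a b g. *)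
Record lie_frame (M : manifold) (B : vbundle M) := LieFrame {
  lf_chart : chart M (mdim M);
  lf_frame : 'I_(vrank B) -> sec B;
  lf_anchor : 'I_(vrank B) -> 'I_(mdim M) -> M -> R;
  lf_struct : 'I_(vrank B) -> 'I_(vrank B) -> 'I_(vrank B) -> M -> R }.

(* K consists of the components, over V, of the generalized Lie algebroid A.
   The bracket of A acts on global sections, so the bracket of the local
   sections t_a is computed near each point on global extensions of their
   germs. *)
Definition represents (M : manifold) (h : diffeo M M) (F : vbundle M)
    (A : gen_lie_algebroid h (diffeo_id M) F) (V : set M) (K : lie_frame F) :=
  [/\ smooth_chart (lf_chart K),
      open V /\ V `<=` cdom (lf_chart K),
      is_frame V (lf_frame K),
      (forall a i, smooth_on V (lf_anchor K a i)) /\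
      (forall a x, V x -> anchor A x (lf_frame K a x) =
         \sum_i lf_anchor K a i x *: coord_frame (lf_chart K) i x) &
      (forall a b g, smooth_on V (lf_struct K a b g)) /\
      (forall x, V x -> exists u : 'I_(vrank F) -> sec F,
         [/\ forall a, smooth_sec setT (u a),
             forall a, \forall y \near x, u a y = lf_frame K a y &
             forall a b, bracket A (u a) (u b) x =
               \sum_g lf_struct K a b g x *: lf_frame K g x])].

Definition pull_frame (M : manifold) (h : diffeo M M) (F : vbundle M)
    (K : lie_frame F) : lie_frame (pullback h F) :=
  @LieFrame M (pullback h F) (lf_chart K)
    (fun a x => lf_frame K a (h x))
    (fun a i x => lf_anchor K a i (h x))
    (fun a b g x => lf_struct K a b g (h x)).

Section local.
Variables (M : manifold) (B : vbundle M) (K : lie_frame B).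
Let r := vrank B.

Definition comp (Z : sec B) (a : 'I_r) (x : M) : R :=
  coords (lf_frame K) (Z x) 0 a.

Definition lf_anchor_field (Z : sec B) : sec (tangent M) := fun x =>
  \sum_a \sum_i (comp Z a x * lf_anchor K a i x) *: coord_frame (lf_chart K) i x.

Definition act (Z : sec B) (f : M -> R) : M -> R := vact (lf_anchor_field Z) f.

(* The expansion of [Z^a T_a, V^b T_b] by the rules for [T_a, T_b],
   [T_a, f T_b] and [f T_a, T_b]. *)
Definition lf_bracket (Z V : sec B) : sec B := fun x =>
  \sum_g (\sum_a \sum_b comp Z a x * comp V b x * lf_struct K a b g x
          + act Z (comp V g) x - act V (comp Z g) x) *: lf_frame K g x.

Definition cochain (q : nat) := ('I_q -> sec B) -> M -> R.

Definition form_eq (U : set M) q (w w' : cochain q) :=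
  forall z : 'I_q -> sec B, (forall i, smooth_sec U (z i)) ->
  forall x, U x -> w z x = w' z x.

Definition wedge q s (w : cochain q) (w' : cochain s) : cochain (q + s) :=
  fun z x => (q`!%:R * s`!%:R)^-1 * \sum_(p : 'S_(q + s))
    (-1) ^+ p * w (fun i => z (p (lshift s i))) x *
                w' (fun j => z (p (rshift q j))) x.

(* For i < j, the map k |-> bump j (bump i k) enumerates the indices other than
   i and j. *)
Definition extd q (w : cochain q) : cochain q.+1 := fun z x =>
  \sum_(i < q.+1) (-1) ^+ i * act (z i) (w (fun k => z (lift i k))) x +
  \sum_(i < q.+1) \sum_(j < q.+1 | (i < j)%N) (-1) ^+ (i + j) *
    w (fun k : 'I_q => if k == 0%N :> nat then lf_bracket (z i) (z j)
                       else z (inord (bump j (bump i k.-1)))) x.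

Definition coframe (a : 'I_r) : cochain 1 := fun z => comp (z ord0) a.

(* The covariant derivative of sections of E with components G^a_bc (written
   G a b c) in the frame s of E and the frame T of B: the additive operator with
   D_Z (f u) = f D_Z u + (Z f) u and D_(T_c) s_b = G^a_bc s_a. *)
Definition covd (E : vbundle M) (s : 'I_(vrank E) -> sec E)
    (G : 'I_(vrank E) -> 'I_(vrank E) -> 'I_r -> M -> R)
    (Z : sec B) (u : sec E) : sec E := fun x =>
  \sum_a (act Z (fun y => coords s (u y) 0 a) x +
          \sum_b \sum_c G a b c x * comp Z c x * coords s (u x) 0 b) *: s a x.

Definition conn_form (k : nat) (G : 'I_k -> 'I_k -> 'I_r -> M -> R)
    (a b : 'I_k) : cochain 1 :=
  fun z x => \sum_c G a b c x * coframe c z x.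

Definition torsion (G : 'I_r -> 'I_r -> 'I_r -> M -> R) (Z V : sec B) : sec B :=
  fun x => covd (lf_frame K) G Z V x - covd (lf_frame K) G V Z x
           - lf_bracket Z V x.

(* With the normalization of wedge the 2-form with skew-symmetric components
   w_ab = w(T_a, T_b) is the sum of the w_ab T^a /\ T^b over the pairs a < b, so
   this is how repeated pairs of form indices are summed. *)
Definition two_form (w : 'I_r -> 'I_r -> M -> R) : cochain 2 := fun z x =>
  \sum_(a < r) \sum_(b < r | (a < b)%N) w a b x * wedge (coframe a) (coframe b) z x.

Definition torsion_form (G : 'I_r -> 'I_r -> 'I_r -> M -> R) (c : 'I_r) :
    cochain 2 :=
  two_form (fun a b => comp (torsion G (lf_frame K a) (lf_frame K b)) c).

Definition curvature (E : vbundle M) (s : 'I_(vrank E) -> sec E)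
    (G : 'I_(vrank E) -> 'I_(vrank E) -> 'I_r -> M -> R)
    (Z V : sec B) (u : sec E) : sec E := fun x =>
  covd s G Z (covd s G V u) x - covd s G V (covd s G Z u) x
  - covd s G (lf_bracket Z V) u x.

(* The form R^a_b takes the value of the a-th component of R(Z, V) s_b at
   (Z, V): its components come from R(T_c, T_d) s_b, as those of the torsion
   come from T(T_c, T_d). With R(T_d, T_c) s_b the form would change sign and
   the second structure equation would fail. *)
Definition curvature_form (E : vbundle M) (s : 'I_(vrank E) -> sec E)
    (G : 'I_(vrank E) -> 'I_(vrank E) -> 'I_r -> M -> R)
    (a b : 'I_(vrank E)) : cochain 2 :=
  two_form (fun c d x =>
    coords s (curvature s G (lf_frame K c) (lf_frame K d) (s b) x) 0 a).

End local.
End algebroids.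

(* Main.v *)
(** Both sides of each identity are function-bilinear in the two sections, so
    each is [\sum_(c, d) w_cd Z^c V^d] and it suffices to compare the components
    [w_cd] on the frame.  For [d S^a] and [d Omega^a_b] the bilinearity comes
    from the cancellation, by the Leibniz rule, of the derivatives of the
    components of [Z] and [V] against those in the bracket; it needs these
    components to be differentiable, which is Cramer's rule.  The skew-symmetry
    of the structure functions turns the sum over [c < d] defining the torsion
    and curvature forms into the full double sum. *)
Require Import Defs.
From mathcomp Require Import all_boot all_order all_algebra.
From mathcomp Require Import boolp classical_sets functions reals topology.
From mathcomp Require Import normedtype derive.
From mathcomp Require Import perm ring.
Import GRing.Theory Num.Theory numFieldNormedType.Exports.
Local Open Scope classical_set_scope.
Local Open Scope ring_scope.

Set Implicit Arguments.
Unset Strict Implicit.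
Unset Printing Implicit Defensive.

(** * Differentiability of determinants and adjugates *)

Section DifferentiableDeterminant.
Context {R : realType} {V : normedModType R}.

Lemma differentiable_bigsum (I : Type) (s : seq I) (f : I -> V -> R) x :
  (forall i, differentiable (f i) x) ->
  differentiable (fun y => \sum_(i <- s) f i y) x.
Proof.
move=> df; elim: s => [|i s IH].
  by under eq_fun do rewrite big_nil; exact: differentiable_cst.
under eq_fun do rewrite big_cons; exact: (@differentiableD _ _ _ (f i)).
Qed.

Lemma differentiable_bigprod (I : Type) (s : seq I) (f : I -> V -> R) x :
  (forall i, differentiable (f i) x) ->
  differentiable (fun y => \prod_(i <- s) f i y) x.
Proof.
move=> df; elim: s => [|i s IH].
  by under eq_fun do rewrite big_nil; exact: differentiable_cst.
under eq_fun do rewrite big_cons; exact: (@differentiableM _ _ (f i)).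
Qed.

Lemma differentiable_det n (A : V -> 'M[R]_n) x :
  (forall i j, differentiable (fun y => A y i j) x) ->
  differentiable (fun y => \det (A y)) x.
Proof.
move=> dA; apply: differentiable_bigsum => p.
apply: (@differentiableM _ _ (fun=> _)); first exact: differentiable_cst.
exact: differentiable_bigprod.
Qed.

Lemma differentiable_adj n (A : V -> 'M[R]_n) x i j :
  (forall i j, differentiable (fun y => A y i j) x) ->
  differentiable (fun y => (\adj (A y)) i j) x.
Proof.
move=> dA; under eq_fun do rewrite mxE.
apply: (@differentiableM _ _ (fun=> _)); first exact: differentiable_cst.
by apply: differentiable_det => k l; under eq_fun do rewrite !mxE.
Qed.

End DifferentiableDeterminant.

(** * Functions on a manifold and their derivatives along vector fields *)

Section Directional.
Context {R : realType} {M : @manifold R}.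
Implicit Types (X : sec (tangent M)) (f g : M -> R).

(** Stated in [chart_at x] alone, the chart in which [vact] differentiates at [x]. *)
Definition mdiff (W : normedModType R) (f : M -> W) (x : M) :=
  differentiable (f \o cinv (chart_at x)) (cmap (chart_at x) x).

Lemma near_cinv (P : set M) (c : @chart R M (mdim M)) (x : M) : cdom c x ->
  (\forall y \near x, P y) -> \forall z \near cmap c x, P (cinv c z).
Proof. by move=> cx nP; apply: (cinv_cont cx); rewrite cmapK. Qed.

Lemma smooth_mdiff (W : normedModType R) (U : set M) (f : M -> W) x :
  U x -> smooth_on U f -> mdiff f x.
Proof.
move=> Ux /(_ _ (chart_at_atlas x) 1%N) [+ _]; apply.
by exists x => //; split=> //; exact: chart_at_dom.
Qed.

Lemma mdiff_near (W : normedModType R) (f g : M -> W) x :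
  (\forall y \near x, f y = g y) -> mdiff f x -> mdiff g x.
Proof.
by move=> /(near_cinv (chart_at_dom x)) fg; apply: differentiable_near fg.
Qed.

Lemma vact_near X f g x :
  (\forall y \near x, f y = g y) -> vact X f x = vact X g x.
Proof. by move=> /(near_cinv (chart_at_dom x)) fg; apply: near_eq_derive fg. Qed.

Lemma vact_cst X (a : R) x : vact X (fun=> a) x = 0.
Proof. exact: derive_cst. Qed.

Lemma vact_near_cst X f (a : R) x : (\forall y \near x, f y = a) -> vact X f x = 0.
Proof. by move=> fa; rewrite (vact_near X (g := fun=> a)) // vact_cst. Qed.

Lemma vactM X f g x : mdiff f x -> mdiff g x ->
  vact X (fun y => f y * g y) x = f x * vact X g x + vact X f x * g x.
Proof.
move=> df dg; rewrite [RHS]addrC [_ * g x]mulrC [RHS]addrC /vact.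
rewrite (@deriveM _ _ _ _ _ _ (diff_derivable df) (diff_derivable dg)) /=.
by rewrite cmapK //; exact: chart_at_dom.
Qed.

Lemma vactD X f g x : mdiff f x -> mdiff g x ->
  vact X (fun y => f y + g y) x = vact X f x + vact X g x.
Proof.
move=> df dg.
exact: (@deriveD _ _ _ _ _ _ _ (diff_derivable df) (diff_derivable dg)).
Qed.

Lemma mdiffM f g x : mdiff f x -> mdiff g x -> mdiff (fun y => f y * g y) x.
Proof. by move=> df dg; exact: (@differentiableM _ _ _ _ _ df dg). Qed.

Lemma mdiff_sum (I : Type) (s : seq I) (f : I -> M -> R) x :
  (forall i, mdiff (f i) x) -> mdiff (fun y => \sum_(i <- s) f i y) x.
Proof.
by move=> df; apply: (@differentiable_bigsum _ _ _ _ (fun i => f i \o _)).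
Qed.

Lemma vact_sum (I : Type) (s : seq I) X (f : I -> M -> R) x :
  (forall i, mdiff (f i) x) ->
  vact X (fun y => \sum_(i <- s) f i y) x = \sum_(i <- s) vact X (f i) x.
Proof.
move=> df; elim: s => [|i s IH].
  by under eq_fun do rewrite big_nil; rewrite big_nil vact_cst.
under eq_fun do rewrite big_cons.
rewrite big_cons vactD // ?IH //.
exact: mdiff_sum.
Qed.

(** A directional derivative of a differentiable function is the value of its differential, which is
    linear in the direction. Only the values at [x] enter, so the coefficients [a i] may be
    arbitrary functions. *)
Lemma vact_comb (I : finType) (a : I -> M -> R) (Y : I -> sec (tangent M)) X f x :
  X x = \sum_i a i x *: Y i x -> mdiff f x ->
  vact X f x = \sum_i a i x * vact (Y i) f x.
Proof.
move=> Xx df; rewrite /vact Xx deriveE // linear_sum.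
by apply: eq_bigr => i _; rewrite linearZ (deriveE _ df).
Qed.

End Directional.

(** * Coordinates of sections in a local frame *)

Section Frames.
Context {R : realType} {M : @manifold R} {B : @vbundle R M}.
Variables (U : set M) (t : 'I_(vrank B) -> sec B).
Hypotheses (oU : open U) (tU : is_frame U t).

Lemma coordsP x (v : B x) : U x -> v = \sum_i coords t v 0 i *: t i x.
Proof.
move=> Ux; have [c [vc _]] := tU.2 x Ux v.
by rewrite /coords; case: xgetP => [d -> //|/(_ c)/(_ vc)].
Qed.

Lemma coords_uniq x (v : B x) (c : 'rV[R]_(vrank B)) :
  U x -> v = \sum_i c 0 i *: t i x -> coords t v = c.
Proof.
move=> Ux vc; have [d [_ dU]] := tU.2 x Ux v.
by rewrite -(dU _ vc); apply/esym/dU/coordsP.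
Qed.

(** Reads off the coordinates of sections defined by their expansion, such as [lf_bracket] and
    [covd]. *)
Lemma coords_comb x (v : B x) (a : 'I_(vrank B) -> R) i :
  U x -> v = \sum_i a i *: t i x -> coords t v 0 i = a i.
Proof.
move=> Ux va; rewrite (@coords_uniq _ _ (\row_i a i)) ?mxE // va.
by apply: eq_bigr => j _; rewrite mxE.
Qed.

Lemma coordsB x (u v : B x) i : U x ->
  coords t (u - v) 0 i = coords t u 0 i - coords t v 0 i.
Proof.
move=> Ux; apply: (coords_comb (a := fun i => coords t u 0 i - coords t v 0 i)) => //.
rewrite {1}(coordsP u Ux) {1}(coordsP v Ux) -sumrB.
by apply: eq_bigr => j _; rewrite scalerBl.
Qed.

Lemma coords_frame x i j : U x -> coords t (t j x) 0 i = (j == i)%:R.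
Proof.
move=> Ux; apply: (coords_comb (a := fun i => (j == i)%:R)) => //.
rewrite (bigD1 j) //= eqxx scale1r big1 ?addr0 // => k /negbTE.
by rewrite eq_sym => ->; rewrite scale0r.
Qed.

(** In a trivialization [p] around [x] the frame becomes an invertible matrix [A], and the
    coordinates of [Z] are [tmap p Z] times the inverse of [A], which Cramer's rule writes through
    [\det] and [\adj]. *)
Lemma mdiff_coords (Z : sec B) x i : U x -> smooth_sec U Z ->
  mdiff (fun y => coords t (Z y) 0 i) x.
Proof.
move=> Ux sZ; have [p [ap px]] := vatlas_cover B x.
have oUp : open (U `&` tdom p) by apply: openI => //; exact: tdom_open.
pose A y := \matrix_(j, k) tmap p (t j y) 0 k.
have tmap0 y : tdom p y -> tmap p (0 : B y) = 0.
  move=> py; have := tmap_linear py 1 0 0; rewrite !scale1r addr0 => e.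
  by apply: (addrI (tmap p (0 : B y))); rewrite -e addr0.
have tmap_comb y (c : 'rV[R]_(vrank B)) : tdom p y ->
    tmap p (\sum_j c 0 j *: t j y) = c *m A y.
  move=> py; rewrite mulmx_sum_row.
  elim: (index_enum _) => [|j s IH]; first by rewrite !big_nil tmap0.
  rewrite !big_cons tmap_linear // IH; congr (_ *: _ + _).
  by apply/rowP => k; rewrite !mxE.
(* A row killed by [A y] gives a vanishing combination of the frame at [y], so uniqueness of
   coordinates makes it zero. *)
have unitA y : U y -> tdom p y -> A y \in unitmx.
  move=> Uy py; rewrite -row_free_unit -kermx_eq0; apply/eqP/row_matrixP => j.
  rewrite row0; set c := row j _.
  have cA : c *m A y = 0 by rewrite /c -row_mul mulmx_ker row0.
  have c0 : \sum_j c 0 j *: t j y = 0.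
    by apply: (can_inj (tmapK py)); rewrite tmap_comb // cA tmap0.
  rewrite -(coords_uniq Uy (esym c0)); apply: (coords_uniq Uy).
  by apply/esym/big1 => k _; rewrite mxE scale0r.
have coordsE y : U y -> tdom p y -> coords t (Z y) 0 i =
    \sum_k tmap p (Z y) 0 k * ((\det (A y))^-1 * (\adj (A y)) k i).
  move=> Uy py; have -> : coords t (Z y) = tmap p (Z y) *m invmx (A y).
    by rewrite {2}(coordsP (Z y) Uy) tmap_comb // mulmxK // unitA.
  by rewrite mxE; apply: eq_bigr => k _; rewrite /invmx unitA // mxE.
(* The formula lives on the intersection of [U] and [tdom p]; this suffices, differentiability being
   local. *)
have near_coords : \forall y \near x,
    \sum_k tmap p (Z y) 0 k * ((\det (A y))^-1 * (\adj (A y)) k i) =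
    coords t (Z y) 0 i.
  apply: filterS (open_nbhs_nbhs (conj oUp (conj Ux px))) => y [Uy py].
  by rewrite coordsE.
apply: (mdiff_near near_coords).
have dentry (u : sec B) k : smooth_sec U u -> mdiff (fun y => tmap p (u y) 0 k) x.
  move=> su; have := smooth_mdiff (conj Ux px) (su p ap).
  rewrite /mdiff => du.
  exact: (differentiable_comp du (differentiable_coord _ 0 k)).
have dA j k : mdiff (fun y => A y j k) x.
  by rewrite /A; under eq_fun do rewrite mxE; apply: dentry; exact: tU.1.
apply: mdiff_sum => k.
apply: (@mdiffM _ _ (fun y => tmap p (Z y) 0 k)); first exact: dentry.
apply: (@mdiffM _ _ (fun y => (\det (A y))^-1)).
  apply: (@differentiableV _ _ (fun z => \det (A (cinv (chart_at x) z)))).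
    exact: differentiable_det.
  (* What remains is that the determinant does not vanish at [x] itself. *)
  rewrite /= cmapK; last exact: chart_at_dom.
  by rewrite -unitfE -unitmxE unitA.
exact: differentiable_adj.
Qed.

End Frames.

(* [Defs.comp] is shadowed by the composition of ssrfun. *)
Local Notation comp := Defs.comp.

(** * Wedge products, exterior derivatives and [two_form] in low degree *)

Section LowDegree.
Context {R : realType} {M : @manifold R} {B : @vbundle R M} (K : lie_frame B).
Implicit Types (w : @cochain R M B 1) (x : M).

(** For one-forms the normalizing factor is 1, and the sum over permutations is the Leibniz formula
    for a 2 by 2 determinant. *)
Lemma wedge11 w w' (z : 'I_2 -> sec B) x :
  wedge w w' z x =
    w (fun=> z ord0) x * w' (fun=> z ord_max) x -
    w (fun=> z ord_max) x * w' (fun=> z ord0) x.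
Proof.
pose A := \matrix_(i < 2, j < 2) if i == 0 then w (fun=> z j) x else w' (fun=> z j) x.
have -> : wedge w w' z x = \det A.
  rewrite /wedge mulr1 invr1 mul1r; apply: eq_bigr => p _.
  rewrite !big_ord_recl big_ord0 mulr1 mulrA !mxE /=.
  by congr (_ * w _ x * w' _ x); apply/funext => i;
    congr (z (p _)); apply/val_inj; rewrite /= ord1.
rewrite (expand_det_row _ ord0) !big_ord_recl big_ord0 addr0 /cofactor !det_mx11.
rewrite !mxE /= /bump /= expr0 expr1 mul1r mulN1r mulrN.
have lift00 : lift ord0 0 = ord_max :> 'I_2 by exact/val_inj.
have lift10 : lift ord_max 0 = ord0 :> 'I_2 by exact/val_inj.
by rewrite lift00 lift10.
Qed.

Lemma extd1 w (z : 'I_2 -> sec B) x :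
  extd K w z x = act K (z ord0) (w (fun=> z ord_max)) x -
    act K (z ord_max) (w (fun=> z ord0)) x -
    w (fun=> lf_bracket K (z ord0) (z ord_max)) x.
Proof.
rewrite /extd; congr (_ + _).
  rewrite !big_ord_recl big_ord0 addr0 expr0 expr1 mul1r mulN1r.
  have lift00 : lift ord0 ord0 = ord_max :> 'I_2 by exact/val_inj.
  have lift0 : (fun k : 'I_1 => z (lift ord0 k)) = fun=> z ord_max.
    by apply/funext => k; rewrite ord1 lift00.
  have lift1 : (fun k : 'I_1 => z (lift ord_max k)) = fun=> z ord0.
    by apply/funext => k; rewrite ord1; congr z; exact/val_inj.
  by rewrite lift00 lift0 lift1.
rewrite !big_ord_recl !big_ord0 !big_mkcond !big_ord_recl !big_ord0 /=.
(* The row [i = 1] is empty: no [j < 2] exceeds 1. *)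
rewrite /bump /= !addr0 add0r addn0 [X in _ + X]big1 => [|j]; last first.
  by rewrite ltnNge -ltnS ltn_ord.
rewrite addr0 expr1 mulN1r; congr (- w _ x).
apply/funext => k; rewrite ord1 /=; congr (lf_bracket K _ (z _)).
exact/val_inj.
Qed.

(** The diagonal vanishes because twice [t a a x] is zero, and by skew-symmetry the lower triangle
    is the second term of each [wedge11]. *)
Lemma two_form_skew (t : 'I_(vrank B) -> 'I_(vrank B) -> M -> R)
    (z : 'I_2 -> sec B) x :
  (forall a b, t a b x = - t b a x) ->
  two_form K t z x = \sum_a \sum_b
    t a b x * comp K (z ord0) a x * comp K (z ord_max) b x.
Proof.
move=> skew; pose F a b := t a b x * comp K (z ord0) a x * comp K (z ord_max) b x.
have diag a : F a a = 0.
  have : t a a x *+ 2 = 0 by rewrite mulr2n {1}skew addNr.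
  by rewrite /F => /eqP; rewrite mulrn_eq0 /= => /eqP ->; rewrite !mul0r.
have split3 a : \sum_b F a b =
    \sum_(b < vrank B | (a < b)%N) F a b + \sum_(b < vrank B | (b < a)%N) F a b.
  rewrite (bigID (fun b : 'I_(vrank B) => (a < b)%N)) /=; congr (_ + _).
  rewrite [LHS](bigD1 a) /= ?ltnn // diag add0r; apply: eq_bigl => b.
  by rewrite -leqNgt ltn_neqAle andbC; congr (_ && _).
under [RHS]eq_bigr do rewrite split3.
(* The lower triangle is re-indexed over [a < b], to be matched with the upper one term by term. *)
rewrite big_split /= [X in _ + X](exchange_big_dep xpredT) //= -big_split /=.
apply: eq_bigr => a _; rewrite -big_split /=; apply: eq_bigr => b _.
by rewrite wedge11 /F /coframe [t b a x]skew; ring.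
Qed.

End LowDegree.

(** * Components in a frame and the two structure equations *)

Section StructureEquations.
Context {R : realType} {M : @manifold R} {B : @vbundle R M} (K : lie_frame B).
Variable U : set M.
Hypotheses (oU : open U) (tU : is_frame U (lf_frame K)).
(** The one assumption on the structure functions; stated on the local data alone, it can be
    supplied both for a frame of [F] and for its pull-back. *)
Hypothesis skewL : forall x, U x -> forall a b g,
  lf_struct K a b g x = - lf_struct K b a g x.
Local Notation r := (vrank B).
Local Notation T := (lf_frame K).

Lemma near_U (P : M -> Prop) x : U x -> (forall y, U y -> P y) -> \forall y \near x, P y.
Proof. by move=> Ux UP; apply: filterS (open_nbhs_nbhs (conj oU Ux)). Qed.

Lemma comp_frame (a b : 'I_r) x : U x -> comp K (T b) a x = (b == a)%:R.
Proof. exact: coords_frame. Qed.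

(** The components of a frame section are constant on the open set [U], and [vact] depends only on
    the germ. *)
Lemma act_comp_frame Z a b x : U x -> act K Z (comp K (T b) a) x = 0.
Proof.
move=> Ux; apply: (@vact_near_cst _ _ _ _ (b == a)%:R).
by apply: near_U => // y; exact: comp_frame.
Qed.

(** The anchor field at a point is linear in the components of [Z] there, so [vact_comb] applies. *)
Lemma act_frame Z f x : U x -> mdiff f x ->
  act K Z f x = \sum_c comp K Z c x * act K (T c) f x.
Proof.
move=> Ux df; apply: vact_comb => //; apply: eq_bigr => c _.
rewrite /lf_anchor_field (bigD1 c) //= [X in _ + X]big1 ?addr0; last first.
  move=> a ac; apply: big1 => i _.
  by rewrite comp_frame // eq_sym (negbTE ac) mul0r scale0r.
rewrite scaler_sumr; apply: eq_bigr => i _.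
by rewrite comp_frame // eqxx mul1r scalerA.
Qed.

Lemma comp_bracket Z V g x : U x -> comp K (lf_bracket K Z V) g x =
  \sum_a \sum_b comp K Z a x * comp K V b x * lf_struct K a b g x
  + act K Z (comp K V g) x - act K V (comp K Z g) x.
Proof. by move=> Ux; exact: (@coords_comb _ _ _ U _ tU x _ (fun g => _) g Ux). Qed.

Lemma comp_bracket_frame a b g x : U x ->
  comp K (lf_bracket K (T a) (T b)) g x = lf_struct K a b g x.
Proof.
move=> Ux; rewrite comp_bracket // !act_comp_frame // addr0 subr0.
rewrite (bigD1 a) //= [X in _ + X]big1 ?addr0; last first.
  move=> a' aa; apply: big1 => b' _.
  by rewrite comp_frame // eq_sym (negbTE aa) !mul0r.
rewrite (bigD1 b) //= [X in _ + X]big1 ?addr0; last first.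
  by move=> b' bb; rewrite !comp_frame // [b == _]eq_sym (negbTE bb) mulr0 mul0r.
by rewrite !comp_frame // !eqxx !mul1r.
Qed.

(** The derivatives of components in [extd1] are exactly those in [comp_bracket], and cancel as they
    stand. *)
Lemma extd_coframe a (z : 'I_2 -> sec B) x : U x ->
  extd K (coframe K a) z x = - \sum_c \sum_d
    comp K (z ord0) c x * comp K (z ord_max) d x * lf_struct K c d a x.
Proof. by move=> Ux; rewrite extd1 {3}/coframe comp_bracket // /coframe; ring. Qed.

Lemma extd_conn_form k (G : 'I_k -> 'I_k -> 'I_r -> M -> R) a b
    (z : 'I_2 -> sec B) x :
  U x -> (forall c, smooth_on U (G a b c)) -> (forall i, smooth_sec U (z i)) ->
  extd K (conn_form K G a b) z x = \sum_c \sum_d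
    (act K (T c) (G a b d) x - act K (T d) (G a b c) x -
     \sum_g G a b g x * lf_struct K c d g x) *
    comp K (z ord0) c x * comp K (z ord_max) d x.
Proof.
move=> Ux sG sz; have dG c : mdiff (G a b c) x by exact: smooth_mdiff Ux (sG c).
have dz i c : mdiff (comp K (z i) c) x by exact: (mdiff_coords oU tU c Ux (sz i)).
have actE Z i : act K Z (conn_form K G a b (fun=> z i)) x =
    \sum_c (G a b c x * act K Z (comp K (z i) c) x +
            act K Z (G a b c) x * comp K (z i) c x).
  rewrite /act /conn_form vact_sum => [|c]; last exact: (mdiffM (dG c) (dz i c)).
  by apply: eq_bigr => c _; exact: (vactM _ (dG c) (dz i c)).
rewrite extd1 !actE /conn_form /coframe.
under [X in _ - X]eq_bigr do rewrite comp_bracket //.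
set Z := z ord0; set V := z ord_max.
(* The Leibniz terms that differentiate components of [Z] and [V] cancel against the bracket;
   derivatives of [G] and structure functions remain. *)
transitivity (\sum_d act K Z (G a b d) x * comp K V d x -
  \sum_c act K V (G a b c) x * comp K Z c x -
  \sum_g G a b g x * \sum_c \sum_d comp K Z c x * comp K V d x * lf_struct K c d g x).
  rewrite -!sumrB; apply: eq_bigr => c _.
  move: (act _ Z _ _) (act _ Z _ _) (act _ V _ _) (act _ V _ _) (\sum_a _).
  by move=> *; ring.
under [X in X - _ - _]eq_bigr do rewrite act_frame // mulr_suml.
under [X in _ - X - _]eq_bigr do rewrite act_frame // mulr_suml.
under [X in _ - _ - X]eq_bigr do (rewrite mulr_sumr; under eq_bigr do rewrite mulr_sumr).
(* The sums are reordered so that [c] indexes [Z] and [d] indexes [V] throughout. *)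
rewrite [X in X - _ - _]exchange_big /= [X in _ - _ - X]exchange_big /= -!sumrB.
apply: eq_bigr => c _.
rewrite [X in _ - _ - X]exchange_big /= -!sumrB; apply: eq_bigr => d _.
rewrite !mulrBl !mulr_suml; congr (_ - _ - _); [ring|ring|].
by apply: eq_bigr => g _; ring.
Qed.

(** [W] records the components of [w] at the single point [x], so one formula serves both a coframe
    element, with a Kronecker delta, and a connection form. *)
Lemma wedge_conn_form k (G : 'I_k -> 'I_k -> 'I_r -> M -> R) a b w
    (W : 'I_r -> R) (z : 'I_2 -> sec B) x :
  (forall i, w (fun=> z i) x = \sum_d W d * comp K (z i) d x) ->
  wedge (conn_form K G a b) w z x = \sum_c \sum_d
    (G a b c x * W d - G a b d x * W c) *
    comp K (z ord0) c x * comp K (z ord_max) d x.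
Proof.
move=> wE; rewrite wedge11 !wE /conn_form /coframe !mulr_suml.
under eq_bigr do rewrite mulr_sumr.
under [X in _ - X]eq_bigr do rewrite mulr_sumr.
rewrite [X in _ - X]exchange_big /= -sumrB; apply: eq_bigr => c _.
by rewrite -sumrB; apply: eq_bigr => d _; ring.
Qed.

Lemma comp_covd (E : vbundle M) (s : 'I_(vrank E) -> sec E)
    (G : 'I_(vrank E) -> 'I_(vrank E) -> 'I_r -> M -> R) Z u a x :
  is_frame U s -> U x ->
  coords s (covd K s G Z u x) 0 a =
    act K Z (fun y => coords s (u y) 0 a) x +
    \sum_b \sum_c G a b c x * comp K Z c x * coords s (u x) 0 b.
Proof. by move=> sU Ux; exact: (@coords_comb _ _ _ U _ sU x _ (fun a => _) a Ux). Qed.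

(** The coordinates of [s b] in the frame [s] are constant near [x], so the derivative term of
    [covd] drops out. *)
Lemma coords_covd_basis (E : vbundle M) (s : 'I_(vrank E) -> sec E)
    (G : 'I_(vrank E) -> 'I_(vrank E) -> 'I_r -> M -> R) Z a b x :
  is_frame U s -> U x ->
  coords s (covd K s G Z (s b) x) 0 a = \sum_c G a b c x * comp K Z c x.
Proof.
move=> sU Ux; rewrite comp_covd //.
rewrite /act (@vact_near_cst _ _ _ _ (b == a)%:R); last first.
  by apply: near_U => // y Uy; exact: (coords_frame sU).
rewrite add0r (bigD1 b) //= [X in _ + X]big1 ?addr0; last first.
  move=> b' bb; apply: big1 => c _.
  by rewrite (coords_frame sU) // eq_sym (negbTE bb) mulr0.
by apply: eq_bigr => c _; rewrite (coords_frame sU) // eqxx mulr1.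
Qed.

Lemma sum_comp_frame (F : 'I_r -> R) c x : U x ->
  \sum_d F d * comp K (T c) d x = F c.
Proof.
move=> Ux; rewrite (bigD1 c) //= big1 ?addr0; last first.
  by move=> d dc; rewrite comp_frame // eq_sym (negbTE dc) mulr0.
by rewrite comp_frame // eqxx mulr1.
Qed.

(** The last index of [G] is the direction of differentiation, whence [G c b a] for the derivative
    of [T b] along [T a]. *)
Lemma torsion_frame (G : 'I_r -> 'I_r -> 'I_r -> M -> R) a b c x : U x ->
  comp K (torsion K G (T a) (T b)) c x = G c b a x - G c a b x - lf_struct K a b c x.
Proof.
move=> Ux; rewrite /comp /torsion (coordsB tU) // (coordsB tU) // !coords_covd_basis //.
by rewrite !sum_comp_frame // -comp_bracket_frame.
Qed.

Lemma curvature_frame (E : vbundle M) (s : 'I_(vrank E) -> sec E)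
    (G : 'I_(vrank E) -> 'I_(vrank E) -> 'I_r -> M -> R) a b c d x :
  is_frame U s -> U x ->
  coords s (curvature K s G (T c) (T d) (s b) x) 0 a =
    act K (T c) (G a b d) x - act K (T d) (G a b c) x
    + \sum_e (G a e c x * G e b d x - G a e d x * G e b c x)
    - \sum_g G a b g x * lf_struct K c d g x.
Proof.
(* Near [x] the coordinates of the inner derivative are the functions [G a b d']; the outer
   derivative differentiates them and adds the quadratic term. *)
move=> sU Ux; have covd2 c' d' : coords s (covd K s G (T c') (covd K s G (T d') (s b)) x) 0 a =
    act K (T c') (G a b d') x + \sum_e G a e c' x * G e b d' x.
  rewrite comp_covd //; congr (_ + _).
    apply: vact_near; apply: near_U => // y Uy.
    by rewrite coords_covd_basis // sum_comp_frame.
  apply: eq_bigr => e _; rewrite coords_covd_basis // sum_comp_frame //.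
  by rewrite -mulr_suml sum_comp_frame.
rewrite /curvature (coordsB sU _ _ _ Ux) (coordsB sU _ _ _ Ux) covd2 covd2.
rewrite coords_covd_basis //.
under [X in _ - X = _]eq_bigr do rewrite comp_bracket_frame //.
by rewrite sumrB; ring.
Qed.

Lemma form_sumE (w : @cochain R M B 2) k (w' : 'I_k -> @cochain R M B 2) z x :
  (w + \sum_i w' i) z x = w z x + \sum_i w' i z x.
Proof.
change (w z x + (\sum_i w' i) z x = w z x + \sum_i w' i z x).
by rewrite !fct_sumE.
Qed.

(** On the pair [T c], [T d] the wedge products contribute [G a d c - G a c d] and the exterior
    derivative [- lf_struct K c d a], as in [torsion_frame]. *)
Lemma first_structure_equation (G : 'I_r -> 'I_r -> 'I_r -> M -> R) a :
  form_eq U (torsion_form K G a)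
    (extd K (coframe K a) + \sum_b wedge (conn_form K G a b) (coframe K b)).
Proof.
move=> z sz x Ux; rewrite form_sumE extd_coframe // /torsion_form two_form_skew; last first.
  by move=> c d; rewrite !(torsion_frame _ _ _ _ Ux) skewL //; ring.
under [X in _ + X]eq_bigr => b _.
  rewrite (wedge_conn_form _ _ _ (W := fun d => (d == b)%:R)); last first.
    move=> i; rewrite (bigD1 b) //= eqxx mul1r big1 ?addr0 //.
    by move=> d /negbTE ->; rewrite mul0r.
  over.
rewrite [X in _ + X]exchange_big /= addrC -sumrB; apply: eq_bigr => c _.
rewrite [X in X - _]exchange_big /= -sumrB; apply: eq_bigr => d _.
rewrite torsion_frame // -!mulr_suml sumrB.
have delta (F : 'I_r -> R) e : \sum_b F b * (e == b)%:R = F e.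
  rewrite (bigD1 e) //= eqxx mulr1 big1 ?addr0 // => b.
  by rewrite eq_sym => /negbTE ->; rewrite mulr0.
by rewrite !delta; ring.
Qed.

(** [extd_conn_form] supplies the derivatives and the structure functions of [curvature_frame], the
    wedge products its quadratic sum. *)
Lemma second_structure_equation (E : vbundle M) (s : 'I_(vrank E) -> sec E)
    (G : 'I_(vrank E) -> 'I_(vrank E) -> 'I_r -> M -> R) a b :
  is_frame U s -> (forall c, smooth_on U (G a b c)) ->
  form_eq U (curvature_form K s G a b)
    (extd K (conn_form K G a b) +
     \sum_c wedge (conn_form K G a c) (conn_form K G c b)).
Proof.
move=> sU sG z sz x Ux; rewrite form_sumE extd_conn_form //.
rewrite /curvature_form two_form_skew; last first.
  (* Exchanging [c] and [d] swaps the two derivatives and the two halves of the quadratic sum; the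
     last sum changes sign by [skewL]. *)
  move=> c d; apply: etrans (curvature_frame G a b c d sU Ux) _.
  apply: etrans _ (esym (congr1 -%R (curvature_frame G a b d c sU Ux))).
  rewrite !sumrB.
  under [X in _ - X = _]eq_bigr do rewrite skewL // mulrN.
  rewrite sumrN; move: (act _ _ _ _) (act _ _ _ _) (\sum_e _) (\sum_e _) (\sum_g _).
  by move=> *; ring.
under [X in _ + X]eq_bigr => e _ do
  rewrite (wedge_conn_form _ _ _ (W := fun d => G e b d x)) //.
rewrite [X in _ + X]exchange_big /= -big_split /=; apply: eq_bigr => c _.
rewrite [X in _ + X]exchange_big /= -big_split /=; apply: eq_bigr => d _.
by rewrite (curvature_frame G a b c d sU Ux) -!mulr_suml; ring.
Qed.

End StructureEquations.

(** * Properties of the local data of an algebroid *)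

Section Representation.
Context {R : realType} {M : @manifold R}.

Lemma is_frame_sub (B : vbundle M) (U V : set M) (t : 'I_(vrank B) -> sec B) :
  U `<=` V -> is_frame V t -> is_frame U t.
Proof.
move=> UV [st tV]; split=> [i p ap|x /UV]; last exact: tV.
by apply: smooth_on_sub (st i p ap) => x [/UV].
Qed.

(** Antisymmetry of the bracket is available on global sections, so it is applied to the extensions
    [u] of the frame germs at [x]; uniqueness of coordinates carries it over to the structure
    functions. *)
Lemma lf_struct_skew (h : diffeo M M) (F : vbundle M)
    (A : gen_lie_algebroid h (diffeo_id M) F) (V : set M) (K : lie_frame F) x :
  represents A V K -> V x ->
  forall a b g, lf_struct K a b g x = - lf_struct K b a g x.
Proof.
move=> [_ _ fK _ [_ brK]] Vx a b g; have [u [su _ brE]] := brK _ Vx.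
apply: etrans (esym (@coords_comb _ _ _ V _ fK x _
  (fun g => lf_struct K a b g x) g Vx (brE a b))) _.
apply: (@coords_comb _ _ _ V _ fK x _ (fun g => - lf_struct K b a g x) g Vx).
rewrite bracket_anti // brE -sumrN.
by apply: eq_bigr => i _; rewrite scaleNr.
Qed.

(** The trivializations of the pull-back are those of [F] composed with [h], so smoothness follows
    by composition; the fibre at [x] is that of [F] at [h x]. *)
Lemma is_frame_pull (h : diffeo M M) (F : vbundle M) (V : set M)
    (K : lie_frame F) :
  open V -> is_frame V (lf_frame K) ->
  is_frame (h @^-1` V) (lf_frame (pull_frame h K)).
Proof.
move=> oV [sK fK]; split=> [i _ [p ap <-]|x Vx]; last exact: fK.
apply: (smooth_on_comp _ (dfun_smooth h) (sK i p ap)).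
by apply: openI => //; exact: tdom_open.
Qed.

Lemma smooth_chart_coord (c : @chart R M (mdim M)) j :
  smooth_chart c -> smooth_on (cdom c) (fun y => cmap c y 0 j).
Proof.
move=> sc c' ac' k; have [_ cc'] := sc c' ac'.
have oD := open_cimg (c := c') (cdom_open c).
exact: ((Ck_coord _ _ oD).1 (cc' k) j).
Qed.

(** By the chain rule the Jacobians of the transitions between [c] and [chart_at x] are inverse to
    each other. *)
Lemma vact_coord_frame (c : @chart R M (mdim M)) i j x :
  smooth_chart c -> cdom c x ->
  vact (coord_frame c i) (fun y => cmap c y 0 j) x = (i == j)%:R.
Proof.
move=> sc cx; have [cc' c'c] := sc _ (chart_at_atlas x).
have c'x := chart_at_dom x.
have d1 := trans_diff cc' cx c'x; have d2 := trans_diff c'c c'x cx.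
(* [trans_comp] asks for charts of the atlas, whereas [c] is only compatible with it. *)
have J1 : 'J (cmap (chart_at x) \o cinv c) (cmap c x) *m
    'J (cmap c \o cinv (chart_at x)) (cmap (chart_at x) x) = 1%:M.
  have := @jacobian_comp R _ _ _ _ (cmap c \o cinv (chart_at x)) _ d1.
  rewrite /= (cmapK cx) => /(_ d2) <-; rewrite -(jacobian_id (cmap c x)).
  apply/esym/jacobian_near; last exact: ex_diff.
  have oD := open_cimg (c := c) (cdom_open (chart_at x)).
  have Dx : cimg c (cdom (chart_at x)) (cmap c x) by exists x.
  apply: filterS (open_nbhs_nbhs (conj oD Dx)) => _ [y [y1 y2] <-] /=.
  by rewrite (cmapK y1) (cmapK y2).
pose F := cmap c \o cinv (chart_at x).
transitivity (('D_(coord_frame c i x) F (cmap (chart_at x) x)) 0 j).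
  by rewrite derive_mx ?mxE //; apply: diff_derivable.
rewrite (deriveEjacobian _ d2) /coord_frame -mulmxA J1 mulmx1 mxE eqxx /=.
by rewrite eq_sym.
Qed.

(** The tangent map of the identity, read in [chart_at x] on both sides, is the Jacobian of a
    transition from a chart to itself. *)
Lemma anchor_field_id (A : gen_lie_algebroid (diffeo_id M) (diffeo_id M) (tangent M)) u :
  (forall x (v : tangent M x), anchor A x v = v) ->
  anchor_field (diffeo_id M) (anchor A) u = u.
Proof.
move=> Aid; apply/functional_extensionality_dep => x.
rewrite /anchor_field /= Aid /tangent_map.
by rewrite (trans_id (chart_at_atlas x) (chart_at_dom x)) mulmx1.
Qed.

(* The anchor is a bracket morphism; applied to the coordinate function x^g,
   whose derivatives along the frame are constant, this gives L^g_ab = 0. *)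
Lemma lf_struct_coord_frame
    (A : gen_lie_algebroid (diffeo_id M) (diffeo_id M) (tangent M))
    (V : set M) (K : lie_frame (tangent M)) x :
  (forall x (v : tangent M x), anchor A x v = v) ->
  represents A V K ->
  (forall i x, V x -> lf_frame K i x = coord_frame (lf_chart K) i x) ->
  V x -> forall a b g, lf_struct K a b g x = 0.
Proof.
move=> Aid [sc [oV Vc] _ _ [_ brK]] coordK Vx a b g.
have [u [su nu brE]] := brK _ Vx.
pose f y := cmap (lf_chart K) y 0 g.
have sf : smooth_on (cdom (lf_chart K)) f by exact: smooth_chart_coord.
have nV : \forall y \near x, V y by apply: open_nbhs_nbhs.
have u0 d e : vact (u e) (vact (u d) f) x = 0.
  apply: (@vact_near_cst _ _ _ _ (d == g)%:R).
  apply: filterS (filterI (nu d) nV) => y [udy Vy].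
  rewrite /vact udy coordK //.
  by apply: vact_coord_frame => //; exact: Vc.
have := bracket_anchor A (su a) (su b) (cdom_open (lf_chart K)) sf (Vc _ Vx).
rewrite !anchor_field_id // !u0 subr0 => <-.
rewrite (@vact_comb _ _ _ (fun g => lf_struct K a b g)
  (fun g => coord_frame (lf_chart K) g)).
- rewrite (bigD1 g) //= vact_coord_frame ?eqxx ?mulr1 //; last exact: Vc.
  rewrite big1 ?addr0 // => i /negbTE ig.
  by rewrite vact_coord_frame ?ig ?mulr0 //; exact: Vc.
- by rewrite brE; apply: eq_bigr => i _; rewrite coordK.
- exact: smooth_mdiff (Vc _ Vx) sf.
Qed.

End Representation.

(** * The identities of Cartan type in the three settings *)

Unset Implicit Arguments.

Theorem theorem3p1 (R : realType) (M : @manifold R) :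
  (forall (h : diffeo M M) (F : vbundle M)
     (A : gen_lie_algebroid h (diffeo_id M) F)
     (V : set M) (K : lie_frame F) (U : set M),
     represents A V K -> open U -> U `<=` cdom (lf_chart K) `&` h @^-1` V ->
     let K' := pull_frame h K in
     (forall G : 'I_(vrank F) -> 'I_(vrank F) -> 'I_(vrank F) -> M -> R,
        (forall a b c, smooth_on U (G a b c)) ->
        forall a, form_eq U (torsion_form K' G a)
          (extd K' (coframe K' a) +
           \sum_b wedge (conn_form K' G a b) (coframe K' b))) /\
     (forall (E : vbundle M) (s : 'I_(vrank E) -> sec E)
        (G : 'I_(vrank E) -> 'I_(vrank E) -> 'I_(vrank F) -> M -> R),
        is_frame U s -> (forall a b c, smooth_on U (G a b c)) ->
        forall a b, form_eq U (curvature_form K' s G a b)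
          (extd K' (conn_form K' G a b) +
           \sum_c wedge (conn_form K' G a c) (conn_form K' G c b)))) /\
  (forall (F : vbundle M)
     (A : gen_lie_algebroid (diffeo_id M) (diffeo_id M) F)
     (V : set M) (K : lie_frame F) (U : set M),
     represents A V K -> open U -> U `<=` V ->
     (forall G : 'I_(vrank F) -> 'I_(vrank F) -> 'I_(vrank F) -> M -> R,
        (forall a b c, smooth_on U (G a b c)) ->
        forall a, form_eq U (torsion_form K G a)
          (extd K (coframe K a) +
           \sum_b wedge (conn_form K G a b) (coframe K b))) /\
     (forall (E : vbundle M) (s : 'I_(vrank E) -> sec E)
        (G : 'I_(vrank E) -> 'I_(vrank E) -> 'I_(vrank F) -> M -> R),
        is_frame U s -> (forall a b c, smooth_on U (G a b c)) ->
        forall a b, form_eq U (curvature_form K s G a b)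
          (extd K (conn_form K G a b) +
           \sum_c wedge (conn_form K G a c) (conn_form K G c b)))) /\
  (forall (A : gen_lie_algebroid (diffeo_id M) (diffeo_id M) (tangent M))
     (V : set M) (K : lie_frame (tangent M)) (U : set M),
     (forall x (v : tangent M x), anchor A x v = v) ->
     represents A V K ->
     (forall i x, V x -> lf_frame K i x = coord_frame (lf_chart K) i x) ->
     open U -> U `<=` V ->
     forall G : 'I_(mdim M) -> 'I_(mdim M) -> 'I_(mdim M) -> M -> R,
       (forall i j k, smooth_on U (G i j k)) ->
       (forall i,
          form_eq U (torsion_form K G i)
            (extd K (coframe K i) +
             \sum_j wedge (conn_form K G i j) (coframe K j)) /\
          form_eq U
            (extd K (coframe K i) +
             \sum_j wedge (conn_form K G i j) (coframe K j))
            (\sum_j wedge (conn_form K G i j) (coframe K j))) /\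
       (forall i j,
          form_eq U (curvature_form K (lf_frame K) G i j)
            (extd K (conn_form K G i j) +
             \sum_k wedge (conn_form K G i k) (conn_form K G k j)))).
Proof.
(* With [h] the identity, the data [K] serve directly in place of [pull_frame]; this covers the Lie
   algebroid and the classical case. *)
have id_case (F : vbundle M) (A : gen_lie_algebroid (diffeo_id M) (diffeo_id M) F)
    (V : set M) (K : lie_frame F) (U : set M) (VK : represents A V K) (UV : U `<=` V) :
    is_frame U (lf_frame K) /\
    (forall x, U x -> forall a b g, lf_struct K a b g x = - lf_struct K b a g x).
  split; first by case: VK => _ _ fK _ _; exact: is_frame_sub fK.
  by move=> x /UV; exact: lf_struct_skew VK.
split; [|split].
- move=> h F A V K U VK oU UV K'.
  have UhV : U `<=` h @^-1` V by move=> x /UV[].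
  have fK' : is_frame U (lf_frame K').
    by case: VK => _ [oV _] fK _ _; exact: is_frame_sub UhV (is_frame_pull h oV fK).
  (* The structure functions of [K'] at [x] are those of [K] at [h x]. *)
  have skew x : U x -> forall a b g, lf_struct K' a b g x = - lf_struct K' b a g x.
    by move=> /UhV Vhx a b g; exact: lf_struct_skew VK Vhx a b g.
  split=> [G _ a|E s G sU sG a b]; first exact: first_structure_equation.
  exact: second_structure_equation.
- move=> F A V K U VK oU UV; have [fK skew] := id_case F A V K U VK UV.
  split=> [G _ a|E s G sU sG a b]; first exact: first_structure_equation.
  exact: second_structure_equation.
- move=> A V K U Aid VK coordK oU UV G sG; have [fK skew] := id_case _ A V K U VK UV.
  split=> [i|i j]; last exact: second_structure_equation.
  split; first exact: first_structure_equation.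
  (* [d dx^i = 0]: the structure functions of a coordinate frame vanish, and with them the double
     sum of [extd_coframe]. *)
  move=> z sz x Ux; rewrite form_sumE (extd_coframe fK) // big1.
    by rewrite oppr0 add0r fct_sumE fct_sumE.
  move=> c _; apply: big1 => d _.
  by rewrite (lf_struct_coord_frame Aid VK coordK (UV _ Ux)) mulr0.
Qed.
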